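(* Let $\mathbb{X}$ be a cartesian linearly distributive category (CLDC) with initial object $\bot$. Then the slice category $\mathbb{X}/\bot$ is a compact CLDC, and therefore a semi-additive category.
   Context: The slice category $\mathbb{X}/\bot$ has as objects the maps $a:A\to\bot$ of $\mathbb{X}$, and as maps $(a:A\to\bot)\to(a':A'\to\bot)$ the maps $g:A\to A'$ with $g;a'=a$. Since in a CLDC the object $\bot$ is subterminal (any two parallel maps into $\bot$ are equal), $\mathbb{X}/\bot$ is identified with the full subcategory of $\mathbb{X}$ on those objects $A$ for which there exists a (necessarily unique) map $A\to\bot$. Composition is written in diagrammatic order: $f;g$ means first $f$, then $g$. For finite products write $\times$, terminal object $\top$, projections $\pi^0,\pi^1$, pairing $\langle -,-\rangle$, $t_A:A\to\top$; for finite coproducts write $+$, initial object $\bot$, injections $\iota^0,\iota^1$, copairing $[-,-]$, $b_A:\bot\to A$. The canonical structure isomorphisms are $\alpha^\times_{A,B,C}:(A\times B)\times C\to A\times(B\times C)$, $r^\times_A:A\to A\times\top$, $l^\times_A:A\to\top\times A$, $\sigma^\times_{A,B}:A\times B\to B\times A$, and $\alpha^+_{A,B,C}:A+(B+C)\to(A+B)+C$, $r^+_A:A+\bot\to A$, $l^+_A:\bot+A\to A$, $\sigma^+_{A,B}:A+B\to B+A$. A cartesian linearly distributive category (CLDC) is a category with finite products and finite coproducts (a symmetric linearly distributive category whose tensor is the product and whose par is the coproduct), equipped with natural transformations (linear distributors) $\delta^R_{A,B,C}:(A+B)\times C\to A+(B\times C)$ and $\delta^L_{A,B,C}:A\times(B+C)\to(A\times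 B)+C$ such that for all objects: (1) $l^\times_{A+B};\delta^L_{\top,A,B}=l^\times_A+1_B$; $r^\times_{A+B};\delta^R_{A,B,\top}=1_A+r^\times_B$; $\delta^R_{\bot,A,B};l^+_{A\times B}=l^+_A\times 1_B$; $\delta^L_{A,B,\bot};r^+_{A\times B}=1_A\times r^+_B$. (2) $\delta^L_{A\times B,C,D};(\alpha^\times_{A,B,C}+1_D)=\alpha^\times_{A,B,C+D};(1_A\times\delta^L_{B,C,D});\delta^L_{A,B\times C,D}$; $(\alpha^+_{A,B,C}\times 1_D);\delta^R_{A+B,C,D}=\delta^R_{A,B+C,D};(1_A+\delta^R_{B,C,D});\alpha^+_{A,B,C\times D}$; $\delta^L_{A,B,C+D};\alpha^+_{A\times B,C,D}=(1_A\times\alpha^+_{B,C,D});\delta^L_{A,B+C,D};(\delta^L_{A,B,C}+1_D)$; $\alpha^\times_{A+B,C,D};\delta^R_{A,B,C\times D}=(\delta^R_{A,B,C}\times 1_D);\delta^R_{A,B\times C,D};(1_A+\alpha^\times_{B,C,D})$. (3) $\delta^L_{A+B,C,D};(\delta^R_{A,B,C}+1_D)=\delta^R_{A,B,C+D};(1_A+\delta^L_{B,C,D});\alpha^+_{A,B\times C,D}$; $(\delta^L_{A,B,C}\times 1_D);\delta^R_{A\times B,C,D}=\alpha^\times_{A,B+C,D};(1_A\times\delta^R_{B,C,D});\delta^L_{A,B,C\times D}$. (4) $\delta^R_{A,B,C}=\sigma^\times_{A+B,C};(1_C\times\sigma^+_{A,B});\delta^L_{C,B,A};(\sigma^\times_{C,B}+1_A);\sigma^+_{B\times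 C,A}$. Let $m:\bot\to\top$ be the unique map. The mix map $\mathrm{mix}_{A,B}:A\times B\to A+B$ is the composite $(1_A\times (l^+_B)^{-1});(1_A\times(m+1_B));\delta^L_{A,\top,B};((r^\times_A)^{-1}+1_B)$. A CLDC is isomix if $m$ is an isomorphism, and compact if it is isomix and every $\mathrm{mix}_{A,B}$ is an isomorphism. A semi-additive category is a category with a zero object, finite products and finite coproducts such that the canonical natural transformation $\psi_{A,B}=[\langle 1_A,0_{A,B}\rangle,\langle 0_{B,A},1_B\rangle]:A+B\to A\times B$ is an isomorphism, where $0_{A,B}$ is the map factoring through the zero object. *)

(* Defs.v *)
From Stdlib Require Import ProofIrrelevance.

Set Implicit Arguments.
Unset Strict Implicit.
Unset Printing Implicit Defensive.

Declare Scope cat_scope.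
Delimit Scope cat_scope with cat.

Reserved Notation "A ~> B" (at level 70, no associativity).
Reserved Notation "f ;; g" (at level 55, left associativity).
Reserved Notation "A × B" (at level 40, left associativity).
Reserved Notation "f ⊠ g" (at level 40, left associativity).
Reserved Notation "f ⊞ g" (at level 50, left associativity).
Reserved Notation "⟨ f , g ⟩" (at level 0, f, g at level 99).
Reserved Notation "⟦ f , g ⟧" (at level 0, f, g at level 99).

(* Composition is written in diagrammatic order: [f ;; g] is first [f]. *)
Record Category : Type := {
  ob :> Type;
  hom : ob -> ob -> Type;
  idm : forall A : ob, hom A A;
  comp : forall A B C : ob, hom A B -> hom B C -> hom A C;
  comp_id_l : forall (A B : ob) (f : hom A B), comp (idm A) f = f;
  comp_id_r : forall (A B : ob) (f : hom A B), comp f (idm B) = f;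
  comp_assoc : forall (A B C D : ob) (f : hom A B) (g : hom B C) (h : hom C D),
    comp f (comp g h) = comp (comp f g) h
}.

Bind Scope cat_scope with ob.
Bind Scope cat_scope with hom.
Arguments hom {c} A%_cat B%_cat.
Arguments idm {c} A%_cat.
Arguments comp {c A B C} f%_cat g%_cat.
Open Scope cat_scope.

Notation "A ~> B" := (hom A B) : type_scope.
Notation "f ;; g" := (comp f g) : cat_scope.

Definition is_iso {X : Category} {A B : X} (f : A ~> B) : Prop :=
  exists g : B ~> A, f ;; g = idm A /\ g ;; f = idm B.

Class FiniteProducts (X : Category) : Type := {
  top : X;
  term : forall A : X, A ~> top;
  term_unique : forall (A : X) (f : A ~> top), f = term A;
  prod : X -> X -> X;
  pi0 : forall A B : X, prod A B ~> A;
  pi1 : forall A B : X, prod A B ~> B;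
  pair : forall {Z A B : X}, Z ~> A -> Z ~> B -> Z ~> prod A B;
  pair_pi0 : forall (Z A B : X) (f : Z ~> A) (g : Z ~> B),
    pair f g ;; pi0 A B = f;
  pair_pi1 : forall (Z A B : X) (f : Z ~> A) (g : Z ~> B),
    pair f g ;; pi1 A B = g;
  pair_unique : forall (Z A B : X) (f : Z ~> A) (g : Z ~> B) (h : Z ~> prod A B),
    h ;; pi0 A B = f -> h ;; pi1 A B = g -> h = pair f g
}.

Class FiniteCoproducts (X : Category) : Type := {
  bot : X;
  init : forall A : X, bot ~> A;
  init_unique : forall (A : X) (f : bot ~> A), f = init A;
  coprod : X -> X -> X;
  inj0 : forall A B : X, A ~> coprod A B;
  inj1 : forall A B : X, B ~> coprod A B;
  copair : forall {A B Z : X}, A ~> Z -> B ~> Z -> coprod A B ~> Z;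
  inj0_copair : forall (A B Z : X) (f : A ~> Z) (g : B ~> Z),
    inj0 A B ;; copair f g = f;
  inj1_copair : forall (A B Z : X) (f : A ~> Z) (g : B ~> Z),
    inj1 A B ;; copair f g = g;
  copair_unique : forall (A B Z : X) (f : A ~> Z) (g : B ~> Z) (h : coprod A B ~> Z),
    inj0 A B ;; h = f -> inj1 A B ;; h = g -> h = copair f g
}.

Notation "⊤" := top : cat_scope.
Notation "⊥" := bot : cat_scope.
Notation "A × B" := (prod A B) : cat_scope.
Notation "A + B" := (coprod A B) : cat_scope.
Notation "⟨ f , g ⟩" := (pair f g) : cat_scope.
Notation "⟦ f , g ⟧" := (copair f g) : cat_scope.

Definition prod_map {X : Category} {P : FiniteProducts X} {A A' B B' : X}
    (f : A ~> A') (g : B ~> B') : A × B ~> A' × B' :=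
  ⟨ pi0 A B ;; f , pi1 A B ;; g ⟩.

Definition coprod_map {X : Category} {Q : FiniteCoproducts X} {A A' B B' : X}
    (f : A ~> A') (g : B ~> B') : A + B ~> A' + B' :=
  ⟦ f ;; inj0 A' B' , g ;; inj1 A' B' ⟧.

Notation "f ⊠ g" := (prod_map f g) : cat_scope.
Notation "f ⊞ g" := (coprod_map f g) : cat_scope.

Section ProductIsos.
Context {X : Category} {P : FiniteProducts X}.

Definition prodA (A B C : X) : (A × B) × C ~> A × (B × C) :=
  ⟨ pi0 (A × B) C ;; pi0 A B , ⟨ pi0 (A × B) C ;; pi1 A B , pi1 (A × B) C ⟩ ⟩.
Definition prod_r (A : X) : A ~> A × ⊤ := ⟨ idm A , term A ⟩.
Definition prod_l (A : X) : A ~> ⊤ × A := ⟨ term A , idm A ⟩.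
Definition prodC (A B : X) : A × B ~> B × A := ⟨ pi1 A B , pi0 A B ⟩.

Definition prod_r_inv (A : X) : A × ⊤ ~> A := pi0 A ⊤.

Lemma prod_rK (A : X) : prod_r A ;; prod_r_inv A = idm A.
Proof. apply pair_pi0. Qed.

Lemma prod_r_invK (A : X) : prod_r_inv A ;; prod_r A = idm (A × ⊤).
Proof.
transitivity (⟨ pi0 A ⊤ , pi1 A ⊤ ⟩).
- apply pair_unique; unfold prod_r, prod_r_inv; rewrite <- comp_assoc.
  + now rewrite pair_pi0, comp_id_r.
  + now rewrite (term_unique (_ ;; _)), (term_unique (pi1 _ _)).
- symmetry; apply pair_unique; apply comp_id_l.
Qed.

End ProductIsos.

Section CoproductIsos.
Context {X : Category} {Q : FiniteCoproducts X}.

Definition coprodA (A B C : X) : A + (B + C) ~> (A + B) + C :=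
  ⟦ inj0 A B ;; inj0 (A + B) C , ⟦ inj1 A B ;; inj0 (A + B) C , inj1 (A + B) C ⟧ ⟧.
Definition coprod_r (A : X) : A + ⊥ ~> A := ⟦ idm A , init A ⟧.
Definition coprod_l (A : X) : ⊥ + A ~> A := ⟦ init A , idm A ⟧.
Definition coprodC (A B : X) : A + B ~> B + A := ⟦ inj1 B A , inj0 B A ⟧.

Definition coprod_l_inv (A : X) : A ~> ⊥ + A := inj1 ⊥ A.

Lemma coprod_l_invK (A : X) : coprod_l_inv A ;; coprod_l A = idm A.
Proof. apply inj1_copair. Qed.

Lemma coprod_lK (A : X) : coprod_l A ;; coprod_l_inv A = idm (⊥ + A).
Proof.
transitivity (⟦ inj0 ⊥ A , inj1 ⊥ A ⟧).
- apply copair_unique; unfold coprod_l, coprod_l_inv; rewrite comp_assoc.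
  + now rewrite (init_unique (_ ;; _)), (init_unique (inj0 _ _)).
  + now rewrite inj1_copair, comp_id_l.
- symmetry; apply copair_unique; apply comp_id_r.
Qed.

End CoproductIsos.

(* Cartesian linearly distributive structure on a category. *)
Class CLDC (X : Category) : Type := {
  cldc_products :: FiniteProducts X;
  cldc_coproducts :: FiniteCoproducts X;

  deltaR : forall A B C : X, (A + B) × C ~> A + (B × C);
  deltaL : forall A B C : X, A × (B + C) ~> (A × B) + C;

  deltaR_natural : forall (A A' B B' C C' : X)
      (f : A ~> A') (g : B ~> B') (h : C ~> C'),
    ((f ⊞ g) ⊠ h) ;; deltaR A' B' C' = deltaR A B C ;; (f ⊞ (g ⊠ h));
  deltaL_natural : forall (A A' B B' C C' : X)
      (f : A ~> A') (g : B ~> B') (h : C ~> C'),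
    (f ⊠ (g ⊞ h)) ;; deltaL A' B' C' = deltaL A B C ;; ((f ⊠ g) ⊞ h);

  deltaL_top : forall A B : X,
    prod_l (A + B) ;; deltaL ⊤ A B = prod_l A ⊞ idm B;
  deltaR_top : forall A B : X,
    prod_r (A + B) ;; deltaR A B ⊤ = idm A ⊞ prod_r B;
  deltaR_bot : forall A B : X,
    deltaR ⊥ A B ;; coprod_l (A × B) = coprod_l A ⊠ idm B;
  deltaL_bot : forall A B : X,
    deltaL A B ⊥ ;; coprod_r (A × B) = idm A ⊠ coprod_r B;

  deltaL_prodA : forall A B C D : X,
    deltaL (A × B) C D ;; (prodA A B C ⊞ idm D)
    = prodA A B (C + D) ;; (idm A ⊠ deltaL B C D) ;; deltaL A (B × C) D;
  deltaR_coprodA : forall A B C D : X,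
    (coprodA A B C ⊠ idm D) ;; deltaR (A + B) C D
    = deltaR A (B + C) D ;; (idm A ⊞ deltaR B C D) ;; coprodA A B (C × D);
  deltaL_coprodA : forall A B C D : X,
    deltaL A B (C + D) ;; coprodA (A × B) C D
    = (idm A ⊠ coprodA B C D) ;; deltaL A (B + C) D ;; (deltaL A B C ⊞ idm D);
  deltaR_prodA : forall A B C D : X,
    prodA (A + B) C D ;; deltaR A B (C × D)
    = (deltaR A B C ⊠ idm D) ;; deltaR A (B × C) D ;; (idm A ⊞ prodA B C D);

  deltaLR_coprodA : forall A B C D : X,
    deltaL (A + B) C D ;; (deltaR A B C ⊞ idm D)
    = deltaR A B (C + D) ;; (idm A ⊞ deltaL B C D) ;; coprodA A (B × C) D;
  deltaLR_prodA : forall A B C D : X,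
    (deltaL A B C ⊠ idm D) ;; deltaR (A × B) C D
    = prodA A (B + C) D ;; (idm A ⊠ deltaR B C D) ;; deltaL A B (C × D);

  deltaR_deltaL : forall A B C : X,
    deltaR A B C
    = prodC (A + B) C ;; (idm C ⊠ coprodC A B) ;; deltaL C B A
      ;; (prodC C B ⊞ idm A) ;; coprodC (B × C) A
}.

Section Compactness.
Context {X : Category} (L : CLDC X).

Definition mix_unit : ⊥ ~> ⊤ := init ⊤.

Definition mix (A B : X) : A × B ~> A + B :=
  (idm A ⊠ coprod_l_inv B) ;; (idm A ⊠ (mix_unit ⊞ idm B))
  ;; deltaL A ⊤ B ;; (prod_r_inv A ⊞ idm B).

Definition isomix : Prop := is_iso mix_unit.

Definition compact : Prop := isomix /\ forall A B : X, is_iso (mix A B).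

End Compactness.

Record ZeroObject (X : Category) : Type := {
  zero_ob : X;
  to_zero : forall A : X, A ~> zero_ob;
  from_zero : forall A : X, zero_ob ~> A;
  to_zero_unique : forall (A : X) (f : A ~> zero_ob), f = to_zero A;
  from_zero_unique : forall (A : X) (f : zero_ob ~> A), f = from_zero A
}.

Definition zero_map {X : Category} (Z : ZeroObject X) (A B : X) : A ~> B :=
  to_zero Z A ;; from_zero Z B.

Definition psi {X : Category} (Z : ZeroObject X)
    (P : FiniteProducts X) (Q : FiniteCoproducts X) (A B : X) : A + B ~> A × B :=
  ⟦ ⟨ idm A , zero_map Z A B ⟩ , ⟨ zero_map Z B A , idm B ⟩ ⟧.

(* Semi-additivity of a category with chosen finite products and coproducts. *)
Definition semi_additive {X : Category}
    (P : FiniteProducts X) (Q : FiniteCoproducts X) : Prop :=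
  exists Z : ZeroObject X, forall A B : X, is_iso (psi Z P Q A B).

Section Slice.
Context (X : Category) (T : X).

Record slice_ob : Type := SliceOb {
  slice_dom : X;
  slice_map : slice_dom ~> T
}.

Record slice_hom (a a' : slice_ob) : Type := SliceHom {
  slice_arr : slice_dom a ~> slice_dom a';
  slice_comm : slice_arr ;; slice_map a' = slice_map a
}.

Lemma slice_hom_eq (a a' : slice_ob) (f g : slice_hom a a') :
  slice_arr f = slice_arr g -> f = g.
Proof.
destruct f as [f pf], g as [g pg]; simpl; intros e; subst g.
now rewrite (proof_irrelevance _ pf pg).
Qed.

Definition slice_id (a : slice_ob) : slice_hom a a :=
  SliceHom (comp_id_l (slice_map a)).

Lemma slice_comp_comm (a b c : slice_ob) (f : slice_hom a b) (g : slice_hom b c) :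
  slice_arr f ;; slice_arr g ;; slice_map c = slice_map a.
Proof. now rewrite <- comp_assoc, (slice_comm g), (slice_comm f). Qed.

Definition slice_comp (a b c : slice_ob) (f : slice_hom a b) (g : slice_hom b c) :
  slice_hom a c := SliceHom (slice_comp_comm f g).

Definition slice : Category.
Proof.
refine {| ob := slice_ob; hom := slice_hom; idm := slice_id; comp := slice_comp |}.
- intros a b f; apply slice_hom_eq; apply comp_id_l.
- intros a b f; apply slice_hom_eq; apply comp_id_r.
- intros a b c d f g h; apply slice_hom_eq; apply comp_assoc.
Defined.

End Slice.

(* Main.v *)
Require Import Defs.

(** The slice over [⊥] inherits the whole structure of [X] because [⊥] is
    subterminal, and being isomix is already enough for compactness.

    - Subterminality.  A linear distributor is determined on a summand [⊥]:
      by naturality and the unit axioms, copairing [deltaL] with a map that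
      factors through [⊥] just collapses the last summand
      ([deltaL_collapse]), and similarly for [deltaR].  The axiom
      [deltaLR_prodA] equates two maps [(⊥ × (⊥ + ⊥)) × ⊥ ~> (⊥ × ⊥) + (⊥ × ⊥)].
      Followed by [⟦ pi0 , pi1 ⟧], one of them collapses to the last
      coordinate and the other to the first one.  Hence the two projections
      of [⊥ × ⊥] agree.

    - Slices.  Over a subterminal [T] every triangle commutes, so the slice is
      a full subcategory, closed under [×] and [+], and its terminal object is
      [T].  The distributors of [X] restrict, and all axioms restrict verbatim
      except the two that mention the terminal object.  These follow from the
      compatibility of the distributors with projections
      ([deltaL_pi1], [deltaR_pi0]), as [T × A ~> A] is invertible for [A]
      over [T].  When [T] is [⊥] the resulting structure is isomix.

    - Compactness.  In any isomix CLDC the initial object is a zero object,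
      and the unit axioms compute all four components of [mix] relative to the
      projections and injections: [mix] is a two-sided inverse of [psi].  This
      gives compactness and semi-additivity at once. *)

Set Implicit Arguments.
Unset Strict Implicit.
Unset Printing Implicit Defensive.

(** * Calculus of products and coproducts *)

Section Products.
Context {X : Category} {P : FiniteProducts X}.

Lemma term_eq (A : X) (f g : A ~> ⊤) : f = g.
Proof. now rewrite (term_unique f), (term_unique g). Qed.

Lemma pair_ext (Z A B : X) (f g : Z ~> A × B) :
  f ;; pi0 A B = g ;; pi0 A B -> f ;; pi1 A B = g ;; pi1 A B -> f = g.
Proof.
intros e0 e1; rewrite (pair_unique e0 e1).
symmetry; now apply pair_unique.
Qed.

Lemma comp_pair (Y Z A B : X) (h : Y ~> Z) (f : Z ~> A) (g : Z ~> B) :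
  h ;; ⟨ f , g ⟩ = ⟨ h ;; f , h ;; g ⟩.
Proof.
apply pair_unique; rewrite <- comp_assoc.
- now rewrite pair_pi0.
- now rewrite pair_pi1.
Qed.

Lemma prod_map_pi0 (A A' B B' : X) (f : A ~> A') (g : B ~> B') :
  (f ⊠ g) ;; pi0 A' B' = pi0 A B ;; f.
Proof. apply pair_pi0. Qed.

Lemma prod_map_pi1 (A A' B B' : X) (f : A ~> A') (g : B ~> B') :
  (f ⊠ g) ;; pi1 A' B' = pi1 A B ;; g.
Proof. apply pair_pi1. Qed.

Lemma pair_prod_map (Z A A' B B' : X) (u : Z ~> A) (v : Z ~> B)
    (f : A ~> A') (g : B ~> B') :
  ⟨ u , v ⟩ ;; (f ⊠ g) = ⟨ u ;; f , v ;; g ⟩.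
Proof.
unfold prod_map; rewrite comp_pair, !comp_assoc.
now rewrite pair_pi0, pair_pi1.
Qed.

Lemma prod_map_id (A B : X) : idm A ⊠ idm B = idm (A × B).
Proof.
apply pair_ext; rewrite comp_id_l.
- now rewrite prod_map_pi0, comp_id_r.
- now rewrite prod_map_pi1, comp_id_r.
Qed.

Lemma prod_map_comp (A A' A'' B B' B'' : X) (f : A ~> A') (f' : A' ~> A'')
    (g : B ~> B') (g' : B' ~> B'') :
  (f ⊠ g) ;; (f' ⊠ g') = (f ;; f') ⊠ (g ;; g').
Proof.
unfold prod_map at 1; rewrite pair_prod_map; unfold prod_map.
now rewrite !comp_assoc.
Qed.

End Products.

Section Coproducts.
Context {X : Category} {Q : FiniteCoproducts X}.

Lemma init_eq (A : X) (f g : ⊥ ~> A) : f = g.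
Proof. now rewrite (init_unique f), (init_unique g). Qed.

Lemma copair_ext (A B Z : X) (f g : A + B ~> Z) :
  inj0 A B ;; f = inj0 A B ;; g -> inj1 A B ;; f = inj1 A B ;; g -> f = g.
Proof.
intros e0 e1; rewrite (copair_unique e0 e1).
symmetry; now apply copair_unique.
Qed.

Lemma copair_comp (A B Z Y : X) (f : A ~> Z) (g : B ~> Z) (h : Z ~> Y) :
  ⟦ f , g ⟧ ;; h = ⟦ f ;; h , g ;; h ⟧.
Proof.
apply copair_unique; rewrite comp_assoc.
- now rewrite inj0_copair.
- now rewrite inj1_copair.
Qed.

Lemma inj0_coprod_map (A A' B B' : X) (f : A ~> A') (g : B ~> B') :
  inj0 A B ;; (f ⊞ g) = f ;; inj0 A' B'.
Proof. apply inj0_copair. Qed.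

Lemma inj1_coprod_map (A A' B B' : X) (f : A ~> A') (g : B ~> B') :
  inj1 A B ;; (f ⊞ g) = g ;; inj1 A' B'.
Proof. apply inj1_copair. Qed.

Lemma coprod_map_copair (A A' B B' Z : X) (f : A ~> A') (g : B ~> B')
    (u : A' ~> Z) (v : B' ~> Z) :
  (f ⊞ g) ;; ⟦ u , v ⟧ = ⟦ f ;; u , g ;; v ⟧.
Proof.
unfold coprod_map; rewrite copair_comp, <- !comp_assoc.
now rewrite inj0_copair, inj1_copair.
Qed.

Lemma coprod_map_id (A B : X) : idm A ⊞ idm B = idm (A + B).
Proof.
apply copair_ext; rewrite comp_id_r.
- now rewrite inj0_coprod_map, comp_id_l.
- now rewrite inj1_coprod_map, comp_id_l.
Qed.

Lemma coprod_map_comp (A A' A'' B B' B'' : X) (f : A ~> A') (f' : A' ~> A'')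
    (g : B ~> B') (g' : B' ~> B'') :
  (f ⊞ g) ;; (f' ⊞ g') = (f ;; f') ⊞ (g ;; g').
Proof.
unfold coprod_map at 2; rewrite coprod_map_copair; unfold coprod_map.
now rewrite !comp_assoc.
Qed.

Lemma coprod_rK (A : X) : coprod_r A ;; inj0 A ⊥ = idm (A + ⊥).
Proof.
apply copair_ext.
- rewrite comp_assoc; unfold coprod_r.
  now rewrite inj0_copair, comp_id_l, comp_id_r.
- apply init_eq.
Qed.

End Coproducts.

(** * Linear distributors on units *)

Section Distributors.
Context {X : Category} {L : CLDC X}.

(** Naturality along [k] reduces to a last summand [⊥], where the unit axiom
    says that the distributor is an identity up to the unitors. *)
Lemma deltaL_collapse (A B C Z : X) (k : C ~> ⊥) (u : A × B ~> Z) :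
  deltaL A B C ;; ⟦ u , k ;; init Z ⟧ = (idm A ⊠ ⟦ idm B , k ;; init B ⟧) ;; u.
Proof.
assert (factor_u : ⟦ u , k ;; init Z ⟧
    = ((idm A ⊠ idm B) ⊞ k) ;; coprod_r (A × B) ;; u).
{ unfold coprod_r; rewrite coprod_map_copair, copair_comp.
  rewrite prod_map_id, !comp_id_l, <- comp_assoc.
  now rewrite (init_eq (init _ ;; u) (init Z)). }
assert (factor_1 : ⟦ idm B , k ;; init B ⟧ = (idm B ⊞ k) ;; coprod_r B).
{ unfold coprod_r; now rewrite coprod_map_copair, !comp_id_l. }
rewrite factor_u, !comp_assoc, <- deltaL_natural.
rewrite <- (comp_assoc _ (deltaL _ _ _) (coprod_r _)), deltaL_bot.
now rewrite prod_map_comp, factor_1, comp_id_l.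
Qed.

Lemma deltaR_collapse (A B C Z : X) (k : A ~> ⊥) (u : B × C ~> Z) :
  deltaR A B C ;; ⟦ k ;; init Z , u ⟧ = (⟦ k ;; init B , idm B ⟧ ⊠ idm C) ;; u.
Proof.
assert (factor_u : ⟦ k ;; init Z , u ⟧
    = (k ⊞ (idm B ⊠ idm C)) ;; coprod_l (B × C) ;; u).
{ unfold coprod_l; rewrite coprod_map_copair, copair_comp.
  rewrite prod_map_id, !comp_id_l, <- comp_assoc.
  now rewrite (init_eq (init _ ;; u) (init Z)). }
assert (factor_1 : ⟦ k ;; init B , idm B ⟧ = (k ⊞ idm B) ;; coprod_l B).
{ unfold coprod_l; now rewrite coprod_map_copair, !comp_id_l. }
rewrite factor_u, !comp_assoc, <- deltaR_natural.
rewrite <- (comp_assoc _ (deltaR _ _ _) (coprod_l _)), deltaR_bot.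
now rewrite prod_map_comp, factor_1, comp_id_l.
Qed.

(** For [C = ⊥] this is the unit axiom [deltaL_bot] read through the inverse
    unitors; the general case follows by naturality along [⊥ ~> C]. *)
Lemma inj0_deltaL (A B C : X) :
  (idm A ⊠ inj0 B C) ;; deltaL A B C = inj0 (A × B) C.
Proof.
assert (unit_case : (idm A ⊠ inj0 B ⊥) ;; deltaL A B ⊥ = inj0 (A × B) ⊥).
{ rewrite <- (comp_id_r (_ ;; deltaL A B ⊥)), <- coprod_rK, !comp_assoc.
  rewrite <- (comp_assoc _ (deltaL _ _ _)), deltaL_bot, prod_map_comp.
  unfold coprod_r; rewrite inj0_copair, comp_id_l, prod_map_id.
  apply comp_id_l. }
assert (factor : idm A ⊠ inj0 B C
    = (idm A ⊠ inj0 B ⊥) ;; (idm A ⊠ (idm B ⊞ init C))).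
{ now rewrite prod_map_comp, inj0_coprod_map, !comp_id_l. }
rewrite factor, <- comp_assoc, deltaL_natural, comp_assoc, unit_case.
rewrite inj0_coprod_map, prod_map_id.
apply comp_id_l.
Qed.

(** For [A = ⊤] this is the unit axiom [deltaL_top], since projecting away [⊤]
    inverts the unitor; the general case follows by naturality along [A ~> ⊤]. *)
Lemma deltaL_pi1 (A B C : X) :
  deltaL A B C ;; (pi1 A B ⊞ idm C) = pi1 A (B + C).
Proof.
assert (unit_case : deltaL ⊤ B C ;; (pi1 ⊤ B ⊞ idm C) = pi1 ⊤ (B + C)).
{ assert (unitorK : idm (⊤ × (B + C)) = pi1 _ _ ;; prod_l (B + C)).
  { apply pair_ext.
    - apply term_eq.
    - unfold prod_l; now rewrite <- comp_assoc, pair_pi1, comp_id_l, comp_id_r. }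
  rewrite <- (comp_id_l (deltaL ⊤ B C)), unitorK, <- !comp_assoc.
  rewrite (comp_assoc (prod_l _)), deltaL_top, coprod_map_comp.
  unfold prod_l; rewrite pair_pi1, comp_id_l, coprod_map_id.
  apply comp_id_r. }
assert (factor : pi1 A B ⊞ idm C
    = ((term A ⊠ idm B) ⊞ idm C) ;; (pi1 ⊤ B ⊞ idm C)).
{ now rewrite coprod_map_comp, prod_map_pi1, comp_id_l, comp_id_r. }
rewrite factor, comp_assoc, <- deltaL_natural, <- comp_assoc, unit_case.
rewrite prod_map_pi1, coprod_map_id.
apply comp_id_r.
Qed.

Lemma deltaR_pi0 (A B C : X) :
  deltaR A B C ;; (idm A ⊞ pi0 B C) = pi0 (A + B) C.
Proof.
assert (unit_case : deltaR A B ⊤ ;; (idm A ⊞ pi0 B ⊤) = pi0 (A + B) ⊤).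
{ rewrite <- (comp_id_l (deltaR A B ⊤)), <- prod_r_invK, <- !comp_assoc.
  rewrite (comp_assoc (prod_r _)), deltaR_top, coprod_map_comp.
  unfold prod_r; rewrite pair_pi0, comp_id_l, coprod_map_id.
  apply comp_id_r. }
assert (factor : idm A ⊞ pi0 B C
    = (idm A ⊞ (idm B ⊠ term C)) ;; (idm A ⊞ pi0 B ⊤)).
{ now rewrite coprod_map_comp, prod_map_pi0, comp_id_l, comp_id_r. }
rewrite factor, comp_assoc, <- deltaR_natural, <- comp_assoc, unit_case.
rewrite prod_map_pi0, coprod_map_id.
apply comp_id_r.
Qed.

(** By naturality a constant first argument may be replaced by [⊤], where the
    distributor is a unitor. *)
Lemma deltaL_point (A B C : X) (p : ⊤ ~> A) :
  ⟨ term (B + C) ;; p , idm (B + C) ⟩ ;; deltaL A B C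
  = ⟨ term B ;; p , idm B ⟩ ⊞ idm C.
Proof.
assert (factor : forall D : X,
    ⟨ term D ;; p , idm D ⟩ = prod_l D ;; (p ⊠ idm D)).
{ intro D; unfold prod_l; now rewrite pair_prod_map, comp_id_l. }
rewrite !factor, <- (coprod_map_id B C), <- comp_assoc, deltaL_natural.
now rewrite comp_assoc, deltaL_top, coprod_map_comp, comp_id_l.
Qed.

(** * The initial object is subterminal *)

(** On [(⊥ × (⊥ + ⊥)) × ⊥] the two sides of [deltaLR_prodA], followed by
    [⟦ pi0 , pi1 ⟧], collapse to the last and to the first coordinate. *)
Lemma bot_projections : pi0 ⊥ ⊥ = pi1 (⊥ : X) ⊥.
Proof.
assert (init_bot : init (⊥ : X) = idm ⊥) by apply init_eq.
assert (collapseR : deltaR (⊥ × ⊥) ⊥ ⊥ ;; ⟦ pi0 ⊥ ⊥ , pi1 (⊥ : X) ⊥ ⟧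
    = pi1 _ _).
{ assert (H := deltaR_collapse (pi0 ⊥ (⊥ : X)) (pi1 ⊥ (⊥ : X))).
  rewrite init_bot, comp_id_r in H.
  now rewrite H, prod_map_pi1, comp_id_r. }
assert (collapseL : deltaL ⊥ ⊥ (⊥ × ⊥) ;; ⟦ pi0 ⊥ ⊥ , pi1 (⊥ : X) ⊥ ⟧
    = pi0 _ _).
{ assert (H := deltaL_collapse (pi1 ⊥ (⊥ : X)) (pi0 ⊥ (⊥ : X))).
  rewrite init_bot, comp_id_r in H.
  now rewrite H, prod_map_pi0, comp_id_r. }
assert (coordinates :
    pi1 (⊥ × (⊥ + ⊥)) (⊥ : X) = pi0 (⊥ × (⊥ + ⊥)) ⊥ ;; pi0 ⊥ (⊥ + ⊥)).
{ assert (H := f_equal (fun h => h ;; ⟦ pi0 ⊥ ⊥ , pi1 (⊥ : X) ⊥ ⟧)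
    (deltaLR_prodA ⊥ ⊥ ⊥ ⊥)).
  simpl in H; rewrite <- !comp_assoc, collapseR, collapseL in H.
  rewrite prod_map_pi1, prod_map_pi0, !comp_id_r in H.
  unfold prodA in H; now rewrite pair_pi0 in H. }
(* Any map into the middle factor [⊥ + ⊥] serves to reach these coordinates. *)
assert (H := f_equal (fun h =>
  ⟨ ⟨ pi0 ⊥ ⊥ , pi0 ⊥ ⊥ ;; inj0 ⊥ ⊥ ⟩ , pi1 (⊥ : X) ⊥ ⟩ ;; h) coordinates).
simpl in H; now rewrite comp_assoc, pair_pi1, !pair_pi0 in H.
Qed.

Lemma bot_subterminal (A : X) (f g : A ~> ⊥) : f = g.
Proof.
transitivity (⟨ f , g ⟩ ;; pi0 ⊥ ⊥).
- symmetry; apply pair_pi0.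
- rewrite bot_projections; apply pair_pi1.
Qed.

End Distributors.

(** * Isomix structures are compact and semi-additive *)

Section Isomix.
Context {X : Category} (L : CLDC X).
Variable n : (⊤ : X) ~> ⊥.
Hypothesis mix_unitK : mix_unit L ;; n = idm ⊥.
Hypothesis mix_unit_invK : n ;; mix_unit L = idm ⊤.

Definition bot_zero : ZeroObject X.
Proof using L n mix_unitK.
refine {| zero_ob := ⊥; to_zero := fun A => term A ;; n;
          from_zero := fun A => init A |}.
- intros A f; rewrite <- (comp_id_r f), <- mix_unitK, comp_assoc.
  now rewrite (term_unique (f ;; _)).
- intros A f; apply init_unique.
Defined.

Lemma mixE (A B : X) :
  mix L A B = (idm A ⊠ inj1 ⊤ B) ;; deltaL A ⊤ B ;; (pi0 A ⊤ ⊞ idm B).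
Proof.
unfold mix, coprod_l_inv; now rewrite prod_map_comp, inj1_coprod_map, !comp_id_l.
Qed.

(** The zero map [B ~> A] factors through [⊥], so copairing with it collapses
    the second summand. *)
Lemma mix_proj0 (A B : X) :
  mix L A B ;; ⟦ idm A , zero_map bot_zero B A ⟧ = pi0 A B.
Proof.
rewrite mixE, <- !comp_assoc, coprod_map_copair, comp_id_l, comp_id_r.
unfold zero_map; simpl; rewrite deltaL_collapse, prod_map_pi0, comp_id_r.
now rewrite prod_map_pi0, comp_id_r.
Qed.

(** All maps [A × ⊤ ~> B] through [⊥] agree, so the first projection may be
    replaced by the second, and [deltaL_pi1] applies. *)
Lemma mix_proj1 (A B : X) :
  mix L A B ;; ⟦ zero_map bot_zero A B , idm B ⟧ = pi1 A B.
Proof.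
assert (factor : (pi0 A ⊤ ⊞ idm B) ;; ⟦ zero_map bot_zero A B , idm B ⟧
    = (pi1 A ⊤ ⊞ idm B) ;; ⟦ n ;; init B , idm B ⟧).
{ rewrite !coprod_map_copair; unfold zero_map; simpl.
  rewrite !comp_assoc.
  now rewrite (term_eq (pi0 A ⊤ ;; term A) (pi1 A ⊤)). }
rewrite mixE, <- !comp_assoc, factor.
rewrite (comp_assoc (deltaL _ _ _)), deltaL_pi1, comp_assoc, prod_map_pi1.
now rewrite <- comp_assoc, inj1_copair, comp_id_r.
Qed.

Lemma mix_psi (A B : X) : mix L A B ;; psi bot_zero _ _ A B = idm (A × B).
Proof.
apply pair_ext; rewrite comp_id_l, <- comp_assoc; unfold psi; rewrite copair_comp.
- rewrite !pair_pi0; apply mix_proj0.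
- rewrite !pair_pi1; apply mix_proj1.
Qed.

Lemma inj0_psi_mix (A B : X) :
  inj0 A B ;; psi bot_zero _ _ A B ;; mix L A B = inj0 A B.
Proof.
(* As [⊥] is also terminal, the zero map lands in the summand [⊤] as well. *)
assert (zero_inj : zero_map bot_zero A B ;; inj1 ⊤ B = term A ;; inj0 ⊤ B).
{ unfold zero_map; simpl.
  rewrite <- !comp_assoc, (init_eq (init B ;; inj1 ⊤ B) (mix_unit L ;; inj0 ⊤ B)).
  now rewrite (comp_assoc n), mix_unit_invK, comp_id_l. }
unfold psi; rewrite inj0_copair, mixE, !comp_assoc, pair_prod_map, zero_inj.
rewrite <- pair_prod_map, <- (comp_assoc _ _ (deltaL _ _ _)), inj0_deltaL.
rewrite <- comp_assoc, inj0_coprod_map, comp_assoc, pair_pi0.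
apply comp_id_l.
Qed.

Lemma inj1_psi_mix (A B : X) :
  inj1 A B ;; psi bot_zero _ _ A B ;; mix L A B = inj1 A B.
Proof.
(* The zero map into [A] is a point of [A], to which [deltaL_point] applies. *)
assert (point : ⟨ zero_map bot_zero B A , idm B ⟩ ;; (idm A ⊠ inj1 ⊤ B)
    = inj1 ⊤ B ;; ⟨ term (⊤ + B) ;; (n ;; init A) , idm (⊤ + B) ⟩).
{ rewrite pair_prod_map, comp_pair, comp_id_l, !comp_id_r; unfold zero_map; simpl.
  rewrite !comp_assoc.
  now rewrite (term_eq (inj1 ⊤ B ;; term (⊤ + B)) (term B)). }
unfold psi; rewrite inj1_copair, mixE, !comp_assoc, point.
rewrite <- (comp_assoc _ _ (deltaL _ _ _)), deltaL_point.
now rewrite !inj1_coprod_map, comp_id_l, inj1_coprod_map, comp_id_l.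
Qed.

Lemma psi_mix (A B : X) : psi bot_zero _ _ A B ;; mix L A B = idm (A + B).
Proof.
apply copair_ext; rewrite comp_id_r, comp_assoc.
- apply inj0_psi_mix.
- apply inj1_psi_mix.
Qed.

End Isomix.

Lemma isomix_compact (X : Category) (L : CLDC X) : isomix L -> compact L.
Proof.
intros iso; split; [exact iso|].
destruct iso as [n [nK Kn]]; intros A B.
exists (psi (bot_zero nK) _ _ A B); split.
- apply mix_psi.
- now apply psi_mix.
Qed.

Lemma isomix_semi_additive (X : Category) (L : CLDC X) :
  isomix L -> semi_additive (cldc_products (CLDC := L)) (cldc_coproducts (CLDC := L)).
Proof.
intros [n [nK Kn]]; exists (bot_zero nK); intros A B.
exists (mix L A B); split.
- now apply psi_mix.
- apply mix_psi.
Qed.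

(** * Slices over a subterminal object *)

Section SubterminalSlice.
Context {X : Category} (T : X).
Hypothesis subterminal : forall (A : X) (f g : A ~> T), f = g.

Definition slice_lift (a b : slice T) (f : slice_dom a ~> slice_dom b) : a ~> b :=
  @SliceHom X T a b f (subterminal _ _).

Definition slice_products (P : FiniteProducts X) : FiniteProducts (slice T).
Proof using subterminal.
unshelve refine {|
  top := SliceOb (idm T) : ob (slice T);
  term := fun a => @slice_lift a (SliceOb (idm T)) (slice_map a);
  prod := fun a b : slice T => SliceOb (pi0 _ _ ;; slice_map a);
  pi0 := fun a b => @slice_lift (SliceOb (pi0 _ _ ;; slice_map a)) a (pi0 _ _);
  pi1 := fun a b => @slice_lift (SliceOb (pi0 _ _ ;; slice_map a)) b (pi1 _ _);
  pair := fun z a b f g =>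
    @slice_lift z (SliceOb (pi0 _ _ ;; slice_map a)) ⟨ slice_arr f , slice_arr g ⟩
|}.
- intros; apply slice_hom_eq, subterminal.
- intros; apply slice_hom_eq, pair_pi0.
- intros; apply slice_hom_eq, pair_pi1.
- intros z a b f g h e0 e1; apply slice_hom_eq, pair_unique.
  + now rewrite <- e0.
  + now rewrite <- e1.
Defined.

Definition slice_coproducts (Q : FiniteCoproducts X) : FiniteCoproducts (slice T).
Proof using subterminal.
unshelve refine {|
  bot := SliceOb (init T) : ob (slice T);
  init := fun a => @slice_lift (SliceOb (init T)) a (init _);
  coprod := fun a b : slice T => SliceOb ⟦ slice_map a , slice_map b ⟧;
  inj0 := fun a b =>
    @slice_lift a (SliceOb ⟦ slice_map a , slice_map b ⟧) (inj0 _ _);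
  inj1 := fun a b =>
    @slice_lift b (SliceOb ⟦ slice_map a , slice_map b ⟧) (inj1 _ _);
  copair := fun a b z f g =>
    @slice_lift (SliceOb ⟦ slice_map a , slice_map b ⟧) z
      ⟦ slice_arr f , slice_arr g ⟧
|}.
- intros; apply slice_hom_eq, init_unique.
- intros; apply slice_hom_eq, inj0_copair.
- intros; apply slice_hom_eq, inj1_copair.
- intros a b z f g h e0 e1; apply slice_hom_eq, copair_unique.
  + now rewrite <- e0.
  + now rewrite <- e1.
Defined.

(** The unit axiom for the terminal object [T] of the slice: over [T] the
    projection [pi1 T A] is invertible, and modulo it the claim is
    [deltaL_pi1]. *)
Lemma deltaL_subterminal (L : CLDC X) (A B : X) (c : A + B ~> T) (a : A ~> T) :
  ⟨ c , idm (A + B) ⟩ ;; deltaL T A B = ⟨ a , idm A ⟩ ⊞ idm B.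
Proof using subterminal.
assert (unitorK : pi1 T A ;; ⟨ a , idm A ⟩ = idm (T × A)).
{ apply pair_ext; [apply subterminal|].
  now rewrite <- comp_assoc, pair_pi1, comp_id_l, comp_id_r. }
assert (cancel : (pi1 T A ⊞ idm B) ;; (⟨ a , idm A ⟩ ⊞ idm B) = idm _).
{ now rewrite coprod_map_comp, unitorK, comp_id_l, coprod_map_id. }
rewrite <- (comp_id_r (deltaL T A B)), <- cancel, !comp_assoc.
rewrite <- (comp_assoc _ (deltaL _ _ _)), deltaL_pi1, pair_pi1.
apply comp_id_l.
Qed.

Lemma deltaR_subterminal (L : CLDC X) (A B : X) (c : A + B ~> T) (b : B ~> T) :
  ⟨ idm (A + B) , c ⟩ ;; deltaR A B T = idm A ⊞ ⟨ idm B , b ⟩.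
Proof using subterminal.
assert (unitorK : pi0 B T ;; ⟨ idm B , b ⟩ = idm (B × T)).
{ apply pair_ext; [|apply subterminal].
  now rewrite <- comp_assoc, pair_pi0, comp_id_l, comp_id_r. }
assert (cancel : (idm A ⊞ pi0 B T) ;; (idm A ⊞ ⟨ idm B , b ⟩) = idm _).
{ now rewrite coprod_map_comp, unitorK, comp_id_l, coprod_map_id. }
rewrite <- (comp_id_r (deltaR A B T)), <- cancel, !comp_assoc.
rewrite <- (comp_assoc _ (deltaR _ _ _)), deltaR_pi0, pair_pi0.
apply comp_id_l.
Qed.

Definition slice_cldc (L : CLDC X) : CLDC (slice T).
Proof using subterminal.
pose (P := slice_products _); pose (Q := slice_coproducts _).
unshelve refine {|
  cldc_products := P;
  cldc_coproducts := Q;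
  deltaR := fun a b c : slice T =>
    @slice_lift ((a + b) × c) (a + (b × c)) (deltaR _ _ _);
  deltaL := fun a b c : slice T =>
    @slice_lift (a × (b + c)) ((a × b) + c) (deltaL _ _ _)
|}; intros; apply slice_hom_eq.
- apply deltaR_natural.
- apply deltaL_natural.
- apply deltaL_subterminal.
- apply deltaR_subterminal.
- apply deltaR_bot.
- apply deltaL_bot.
- apply deltaL_prodA.
- apply deltaR_coprodA.
- apply deltaL_coprodA.
- apply deltaR_prodA.
- apply deltaLR_coprodA.
- apply deltaLR_prodA.
- apply deltaR_deltaL.
Defined.

End SubterminalSlice.

Lemma slice_bot_isomix (X : Category) (L : CLDC X) :
  isomix (slice_cldc (T := (⊥ : X)) (@bot_subterminal X L) L).
Proof.
(* Both units of the slice have domain [⊥], so the identity of [⊥] inverts the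
   mix map. *)
exists (@slice_lift X ⊥ (@bot_subterminal X L)
  (SliceOb (idm ⊥)) (SliceOb (init ⊥)) (idm ⊥)).
split; apply slice_hom_eq, bot_subterminal.
Qed.

Theorem proposition5p14 (X : Category) (L : CLDC X) :
  exists S : CLDC (slice (⊥ : X)),
    compact S /\ semi_additive (cldc_products (CLDC := S)) (cldc_coproducts (CLDC := S)).
Proof.
exists (slice_cldc (@bot_subterminal X L) L); split.
- apply isomix_compact, slice_bot_isomix.
- apply isomix_semi_additive, slice_bot_isomix.
Qed.
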